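(* For every instance of the Fault-Tolerant Path problem, the optimal value of the instance is at most $k+1$ times the optimal value of the corresponding FRAC-FTP instance. Furthermore, for every $k$ there exists an infinite family of instances of Fault-Tolerant Path with parameter $k$ for which the ratio between the optimal value of Fault-Tolerant Path and the optimal value of FRAC-FTP is arbitrarily close to $k+1$.
   Context: Fault-Tolerant Path (FTP): given a directed graph $D=(V,A)$ with non-negative arc weights $w$, two vertices $s,t\in V$, a set $M\subseteq A$ of vulnerable arcs and an integer $k\in\mathbb{Z}_{\geq 0}$, find a minimum-weight set $S\subseteq A$ such that $S\setminus F$ contains an $s$-$t$ path for every $F\subseteq M$ with $|F|\leq k$. FRAC-FTP (same input): find $x\in[0,1]^A$ minimizing $\sum_{e\in A}w_e x_e$ such that for every $F\subseteq M$ with $|F|\leq k$, the maximum $s$-$t$ flow in $(V,A\setminus F)$ with arc capacities $x$ is at least $1$. *)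

(* Defs.v *)
From HB Require Import structures.
From mathcomp Require Import all_boot all_order all_algebra.
From mathcomp Require Import all_classical all_reals all_analysis.

Set Implicit Arguments.
Unset Strict Implicit.
Unset Printing Implicit Defensive.

Import Order.TTheory GRing.Theory Num.Theory.
Import numFieldNormedType.Exports.

Local Open Scope classical_set_scope.
Local Open Scope ring_scope.

(* Parallel arcs and loops are allowed in an instance; see [simple_digraph]. *)
Record ftp_instance (R : realType) := FTPInstance {
  vertex : finType;
  arc : finType;
  tail : arc -> vertex;
  head : arc -> vertex;
  weight : arc -> R;
  weight_ge0 : forall e, 0 <= weight e;
  source : vertex;
  target : vertex;
  vulnerable : {set arc};
  faults : nat
}.

Section FaultTolerantPath.
Variables (R : realType) (I : ftp_instance R).

Definition simple_digraph : Prop :=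
  injective (fun e : arc I => (tail e, head e)) /\
  (forall e : arc I, tail e != head e).

Definition fault_set (F : {set arc I}) : Prop :=
  (F \subset vulnerable I) && (#|F| <= faults I)%N.

Definition adjacent (B : {set arc I}) : rel (vertex I) :=
  fun u v => [exists e in B, (tail e == u) && (head e == v)].

Definition contains_st_path (B : {set arc I}) : Prop :=
  exists p : seq (vertex I),
    [/\ path (adjacent B) (source I) p, last (source I) p = target I
      & uniq (source I :: p)].

Definition ftp_feasible (S : {set arc I}) : Prop :=
  forall F : {set arc I}, fault_set F -> contains_st_path (S :\: F).

Definition set_weight (S : {set arc I}) : R := \sum_(e in S) weight e.

(* The infimum of an infeasible problem is +oo. *)
Definition ftp_opt : \bar R :=
  ereal_inf [set (set_weight S)%:E | S in [set S | ftp_feasible S]].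

(* s-t flows in the subgraph with arc set B; the values of f outside B are
   irrelevant. *)
Definition st_flow (B : {set arc I}) (x f : arc I -> R) : Prop :=
  (forall e, e \in B -> 0 <= f e <= x e) /\
  (forall v, v != source I -> v != target I ->
     \sum_(e in B | head e == v) f e = \sum_(e in B | tail e == v) f e).

Definition flow_value (B : {set arc I}) (f : arc I -> R) : R :=
  \sum_(e in B | tail e == source I) f e -
  \sum_(e in B | head e == source I) f e.

(* For x >= 0 the set of values is nonempty and bounded, so that the real
   supremum is meaningful. *)
Definition max_flow (B : {set arc I}) (x : arc I -> R) : R :=
  sup [set flow_value B f | f in [set f | st_flow B x f]].

Definition frac_ftp_feasible (x : arc I -> R) : Prop :=
  (forall e, 0 <= x e <= 1) /\
  (forall F : {set arc I}, fault_set F -> 1 <= max_flow (~: F)%SET x).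

Definition frac_weight (x : arc I -> R) : R := \sum_e weight e * x e.

Definition frac_ftp_opt : \bar R :=
  ereal_inf [set (frac_weight x)%:E | x in [set x | frac_ftp_feasible x]].

End FaultTolerantPath.

(* Main.v *)
(** Upper bound.  Let [x] be feasible for FRAC-FTP, and truncate the capacities
    [(k+1) x] at 1 on the vulnerable arcs.  The arcs truncated in an s-t cut of
    value less than [k+1] form a fault set [F]; after its removal the cut still
    has [x]-value at least 1, so its truncated value is at least [k+1] after all.
    Hence these capacities carry a flow of value [k+1] and cost at most [k+1]
    times that of [x].  An integral flow that is no more expensive, with bounds
    1 on the vulnerable arcs and [k+1] on the others, has a fault-tolerant
    support.

    Tightness.  Among [N] parallel vulnerable arcs of unit weight, FTP needs
    [k+1], while the constant [1/(N-k)] is feasible for FRAC-FTP. *)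

From HB Require Import structures.
From mathcomp Require Import all_boot all_order all_algebra.
From mathcomp Require Import all_classical all_reals all_analysis.
From mathcomp Require Import ring lra zify.
Require Import Defs.
Import Order.TTheory GRing.Theory Num.Theory.
Import numFieldNormedType.Exports.
Local Open Scope ring_scope.

Set Implicit Arguments.
Unset Strict Implicit.
Unset Printing Implicit Defensive.

(** * Cuts and flows with prescribed excesses *)

Section Network.
Variables (R : realType) (V A : finType) (tl hd : A -> V).
Implicit Types (f g u w : A -> R) (b : V -> R) (X Y : {set V}) (B : {set A}).

(** Sign [1] for an arc entering [X], [-1] for one leaving it; arcs inside [X] cancel, so excess is
    additive over vertices. *)
Definition incidence (e : A) X : R := (hd e \in X)%:R - (tl e \in X)%:R.

Definition excess B f X : R := \sum_(e in B) f e * incidence e X.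

Definition in_capacity B u X : R :=
  \sum_(e in B) u e * ((hd e \in X) && (tl e \notin X))%:R.

Lemma sum_mem_set1 X (a : V) :
  \sum_(v in X) (a \in [set v])%:R = (a \in X)%:R :> R.
Proof.
under eq_bigr do rewrite inE.
have [aX|aX] := boolP (a \in X); last first.
  by rewrite big1 // => v vX; case: eqP => // av; rewrite av vX in aX.
rewrite (bigD1 a) //= eqxx big1 ?addr0 // => v /andP[_ /negPf].
by rewrite eq_sym => ->.
Qed.

Lemma excess_sum B f X : \sum_(v in X) excess B f [set v] = excess B f X.
Proof.
rewrite exchange_big /=; apply: eq_bigr => e _.
by rewrite -mulr_sumr sumrB !sum_mem_set1.
Qed.

Lemma excess_setT B f : excess B f [set: V] = 0.
Proof. by rewrite /excess big1 // => e _; rewrite /incidence !inE subrr mulr0. Qed.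

Lemma excess_le_in_capacity B f u X :
  (forall e, e \in B -> 0 <= f e <= u e) -> excess B f X <= in_capacity B u X.
Proof.
move=> fu; apply: ler_sum => e /fu /andP[f0 fue]; rewrite /incidence.
by case: (hd e \in X); case: (tl e \in X) => /=; lra.
Qed.

(** Holds arc by arc; only arcs between [X] minus [Y] and [Y] minus [X] make it strict. *)
Lemma in_capacity_submodular B u X Y : (forall e, 0 <= u e) ->
  in_capacity B u (X :|: Y) + in_capacity B u (X :&: Y) <=
  in_capacity B u X + in_capacity B u Y.
Proof.
move=> u0; rewrite -!big_split; apply: ler_sum => e _ /=; rewrite !inE.
have := u0 e.
by case: (hd e \in X); case: (tl e \in X); case: (hd e \in Y);
  case: (tl e \in Y) => /=; lra.
Qed.

Lemma sum_setUI b X Y : \sum_(v in X :|: Y) b v + \sum_(v in X :&: Y) b v =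
  \sum_(v in X) b v + \sum_(v in Y) b v.
Proof.
rewrite !(big_mkcond (fun v => v \in _)) /= -!big_split /=.
apply: eq_bigr => v _; rewrite !inE.
by case: (v \in X); case: (v \in Y) => /=; rewrite ?addr0 ?add0r.
Qed.

(* Gale's supply-demand theorem.  Arcs are eliminated one at a time: a flow
   value [z] on the arc [e0] leaves the cut condition valid for the remaining
   arcs iff it lies between lower bounds indexed by the sets that [e0] enters
   and upper bounds indexed by the sets that it leaves, and these bounds are
   compatible by submodularity. *)
Lemma gale_flow B u b : (forall e, 0 <= u e) -> \sum_v b v = 0 ->
  (forall X, \sum_(v in X) b v <= in_capacity B u X) ->
  exists2 f, forall e, 0 <= f e <= u e & forall v, excess B f [set v] = b v.
Proof.
move=> u0; move Dn: #|B| => n; elim: n B Dn b => [|n IHn] B Bn b sb0 cut.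
  (* Without arcs the cut condition at singletons gives [b <= 0], and the zero sum forces
     [b = 0]. *)
  move/eqP: Bn; rewrite cards_eq0 => /eqP B0; rewrite {}B0 in cut *.
  exists (fun=> 0) => [e|v]; first by rewrite lexx u0.
  have b_le0 v' : b v' <= 0.
    by have := cut [set v']; rewrite big_set1 /in_capacity big_set0.
  have : b v = - \sum_(v' | v' != v) b v'.
    by move: sb0; rewrite (bigD1 v) //=; lra.
  have : \sum_(v' | v' != v) b v' <= 0 by apply: sumr_le0 => v' _; exact: b_le0.
  have := b_le0 v; rewrite /excess big_set0; lra.
have /card_gt0P[e0 e0B] : (0 < #|B|)%N by rewrite Bn.
set B' := B :\ e0.
have B'n : #|B'| = n by apply/eqP; rewrite -eqSS -Bn (cardsD1 e0 B) e0B.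
have cutE X : in_capacity B u X =
    u e0 * ((hd e0 \in X) && (tl e0 \notin X))%:R + in_capacity B' u X.
  by rewrite /in_capacity (big_setD1 e0).
(* The largest lower bound; the default [0] makes [z] nonnegative. *)
pose z := \big[Num.max/0]_(X : {set V} | (hd e0 \in X) && (tl e0 \notin X))
            (\sum_(v in X) b v - in_capacity B' u X).
have z0 : 0 <= z by exact: bigmax_ge_id.
have zlb X : hd e0 \in X -> tl e0 \notin X ->
    \sum_(v in X) b v - in_capacity B' u X <= z.
  move=> hX tX.
  by apply: (le_bigmax_cond _ (fun X => \sum_(v in X) b v - in_capacity B' u X));
    rewrite hX tX.
have zu : z <= u e0.
  apply: bigmax_le => // X hX; have := cut X; rewrite cutE hX /=; lra.
have zub X : hd e0 \notin X -> tl e0 \in X ->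
    z <= in_capacity B' u X - \sum_(v in X) b v.
  move=> hX tX; apply: bigmax_le => [|Y /andP[hY tY]].
    by have := cut X; rewrite cutE (negPf hX) /=; lra.
  (* [e0] enters [Y] and leaves [X], so it crosses neither the union nor the intersection. *)
  have := cut (Y :|: X); have := cut (Y :&: X).
  rewrite !cutE !inE hY tX (negPf hX) (negPf tY) /=.
  have := in_capacity_submodular B' Y X u0; have := sum_setUI b Y X; lra.
(* The excesses still to be realised once [e0] carries [z]. *)
pose b' v := b v - z * incidence e0 [set v].
have sb' X : \sum_(v in X) b' v = \sum_(v in X) b v - z * incidence e0 X.
  by rewrite sumrB -mulr_sumr sumrB !sum_mem_set1.
have [||f fu fb] := IHn B' B'n b'.
- have := sb' [set: V]; rewrite /incidence !inE subrr mulr0 subr0.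
  by rewrite (eq_bigl xpredT) => [->|v]; rewrite ?inE //
    (eq_bigl xpredT) // => v; rewrite inE.
- move=> X; rewrite sb' /incidence.
  have := cut X; rewrite cutE; have := zlb X; have := zub X.
  case: (hd e0 \in X); case: (tl e0 \in X) => //=.
  + lra.
  + by move=> _ /(_ isT isT); lra.
  + by move=> /(_ isT isT); lra.
  + lra.
exists (fun e => if e == e0 then z else f e) => [e|v].
  by case: eqP => [->|_]; rewrite ?z0 ?fu.
rewrite /excess (big_setD1 e0) //= eqxx.
under eq_bigr => e do rewrite !inE => /andP[/negPf -> _].
have := fb v; rewrite /b' /excess => ->; lra.
Qed.

(** * Rounding a flow to an integral one *)

Let degree B (v : V) : nat := \sum_(e in B) ((hd e == v) + (tl e == v)).

Lemma sum_eq_op (a : V) : (\sum_v (a == v))%N = 1%N.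
Proof.
by rewrite (bigD1 a) //= eqxx big1 ?addn0 // => v /negPf; rewrite eq_sym => ->.
Qed.

Lemma sum_degree B : (\sum_v degree B v)%N = (#|B| * 2)%N.
Proof.
rewrite exchange_big /= -sum_nat_const; apply: eq_bigr => e _.
by rewrite big_split /= !sum_eq_op.
Qed.

(* A forest has fewer arcs than vertices.  Here, the conservation
   constraints at all touched vertices but one are fewer than the arcs, and the
   constraint that is left out follows from the others. *)
Lemma circulation_without_leaf B : B != finset.set0 ->
  (forall v, degree B v != 1%N) ->
  exists g, [/\ exists e, g e != 0, forall e, e \notin B -> g e = 0
              & forall v, excess [set: A] g [set v] = 0].
Proof.
case/finset.set0Pn=> e0 e0B deg1.
pose T := [set v | degree B v != 0%N].
have TB : (#|T| <= #|B|)%N.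
  (* Every touched vertex has degree at least 2, while the degrees sum to [2 * #|B|]. *)
  rewrite -(leq_pmul2r (m := 2)) // -sum_degree -sum_nat_const.
  rewrite [X in (_ <= X)%N](bigID (mem T)) /=.
  apply: leq_trans (leq_addr _ _); apply: leq_sum => v; rewrite inE.
  by have := deg1 v; case: (degree B v) => [|[]].
pose v0 := hd e0.
have v0T : v0 \in T by rewrite inE /degree (bigD1 e0) //= eqxx.
pose W := T :\ v0.
have WB : (#|W| < #|B|)%N by apply: leq_trans TB; rewrite (cardsD1 v0 T) v0T.
(* More rows than columns: a nonzero row of the left kernel is a circulation away from [v0]. *)
pose M : 'M[R]_(#|B|, #|W|) :=
  \matrix_(i, j) incidence (enum_val i) [set enum_val j].
have /matrix0Pn[i0 [j0 K0]] : kermx M != 0.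
  by rewrite kermx_eq0 /row_free ltn_eqF // (leq_ltn_trans (rank_leq_col _)).
pose g e := if e \in B then kermx M i0 (enum_rank_in e0B e) else 0.
have gB v : excess [set: A] g [set v] =
    \sum_(e in B) g e * incidence e [set v].
  rewrite /excess big_mkcond [RHS]big_mkcond; apply: eq_bigr => e _.
  by rewrite inE /g; case: (e \in B); rewrite ?mul0r.
have gW v : v != v0 -> excess [set: A] g [set v] = 0.
  move=> vv0; rewrite gB; have [vW|] := boolP (v \in W); last first.
    rewrite !inE vv0 negbK /= => /eqP/eqP.
    rewrite /degree sum_nat_eq0 => /forallP degv.
    rewrite big1 // => e eB; have := degv e; rewrite eB addn_eq0 /incidence !inE.
    by rewrite !eqb0 => /andP[/negPf-> /negPf->]; rewrite subrr mulr0.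
  have /matrixP/(_ i0 (enum_rank_in vW v)) := mulmx_ker M.
  rewrite mxE [RHS]mxE; apply: etrans; rewrite big_enum_val; apply: eq_bigr => i _.
  by rewrite [M _ _]mxE enum_rankK_in // /g enum_valP enum_valK_in.
exists g; split=> [|e /negPf eB|v]; last 2 first.
- by rewrite /g eB.
- have [->|/gW//] := eqVneq v v0.
  have := excess_sum [set: A] g [set: V]; rewrite excess_setT.
  rewrite (bigD1 v0) ?inE //= big1 ?addr0 // => v'.
  by case/andP=> _; exact: gW.
- by exists (enum_val j0); rewrite /g enum_valP enum_valK_in.
Qed.

(** A single fractional term cannot be balanced by integral ones. A loop has degree 2, which agrees
    with its cancelling in the excess. *)
Lemma fractional_degree_neq1 f v :
  excess [set: A] f [set v] \is a Num.int ->
  degree [set e | f e \isn't a Num.int] v != 1%N.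
Proof.
set B := [set e | _] => fint; apply/eqP => deg1.
have [e eB de] : exists2 e, e \in B & ((hd e == v) + (tl e == v))%N != 0%N.
  apply/exists_inP; rewrite -negb_forall_in; apply/negP => /forall_inP d0.
  by move: deg1; rewrite /degree big1 // => e /d0 /eqP.
move: deg1; rewrite /degree (bigD1 e) //= => deg1.
have {deg1}[de1 rest] : (((hd e == v) + (tl e == v)) = 1 /\
    \sum_(i in B | i != e) ((hd i == v) + (tl i == v)) = 0)%N by lia.
move/eqP: rest; rewrite sum_nat_eq0 => /forallP rest.
move: fint; rewrite /excess (bigD1 e) ?inE //= rpredDr; last first.
  apply: rpred_sum => e' /andP[_ ee'].
  have [e'B|] := boolP (e' \in B).
    have := rest e'; rewrite e'B ee' addn_eq0 !eqb0 /incidence !inE /=.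
    by case/andP=> /negPf-> /negPf->; rewrite subrr mulr0 rpred0.
  rewrite inE negbK => fe'; apply: rpredM => //.
  by rewrite rpredB // rpred_nat.
move: eB; rewrite inE /incidence !inE; move: de1.
by case: (hd e == v); case: (tl e == v) => //= _ /negP nf;
  rewrite ?subr0 ?sub0r ?mulrN1 ?mulr1 ?rpredN.
Qed.

Definition cost w f : R := \sum_e w e * f e.

(* While some values are fractional, moving along a circulation supported on
   the fractional arcs, in the direction in which the cost does not increase,
   makes a further value integral. *)
Lemma integral_flow w u f : (forall e, u e \is a Num.int) ->
  (forall e, 0 <= f e <= u e) ->
  (forall v, excess [set: A] f [set v] \is a Num.int) ->
  exists f', [/\ forall e, f' e \is a Num.int, forall e, 0 <= f' e <= u e,
    forall v, excess [set: A] f' [set v] = excess [set: A] f [set v]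
    & cost w f' <= cost w f].
Proof.
move=> uint.
have [n] := ubnP #|[set e | f e \isn't a Num.int]|.
elim: n f => // n IHn f; set B := [set e | _] => Bn fu fint.
have [B0|Bn0] := eqVneq B finset.set0.
  exists f; split=> // e; have : e \notin B by rewrite B0 inE.
  by rewrite inE negbK.
have [g [gn0 gB gc gw]] : exists g, [/\ exists e, g e != 0,
    forall e, e \notin B -> g e = 0,
    forall v, excess [set: A] g [set v] = 0 & cost w g <= 0].
  have [|g [[e ge0] gB gc]] := circulation_without_leaf Bn0.
    by move=> v; apply: fractional_degree_neq1.
  have [gw|gw] := lerP (cost w g) 0; first by exists g; split=> //; exists e.
  exists (fun e => - g e); split=> [|e' /gB->|v|]; rewrite ?oppr0 //.
  - by exists e; rewrite oppr_eq0.
  - apply/eqP; rewrite -oppr_eq0 -[X in _ == X](gc v) /excess -sumrN.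
    by apply/eqP/eq_bigr => ? _; rewrite mulNr opprK.
  - rewrite /cost; under eq_bigr do rewrite mulrN.
    by rewrite sumrN oppr_le0 ltW.
case: gn0 => e1 ge1.
(* The next integer in the direction of [g] on a fractional arc; [r e] is the step length at which
   [e] reaches it. *)
pose h e : R := (Num.floor (f e) + (0 < g e)%R%:Z)%:~R.
pose r e := (h e - f e) / g e.
have hu e : 0 <= h e <= u e.
  have /andP[f0 fue] := fu e; have /andP[lo hi] := floor_itv (f e).
  have fl0 : 0 <= Num.floor (f e) by rewrite floor_ge0.
  have [m um] := intrP (uint e).
  rewrite /h ler0z addr_ge0 //=.
  have [ge|ge] := boolP (0 < g e); last first.
    by rewrite addr0 (le_trans lo).
  have eB : e \in B by apply: contraTT ge => /gB->; rewrite ltxx.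
  (* Since [u e] is integral and [f e] is not, [f e < u e], so rounding up respects the bound. *)
  rewrite um ler_int lezD1 -(ltr_int R) -um (le_lt_trans lo) //.
  rewrite lt_neqAle fue andbT; apply: contraTneq eB => fe.
  by rewrite inE negbK fe.
have r0 e : 0 <= r e.
  have /andP[lo hi] := floor_itv (f e); rewrite /r /h.
  have [ge|] := ltrP 0 (g e).
    by rewrite divr_ge0 ?ltW // subr_gt0.
  move=> ge; rewrite addr0 -mulrNN mulr_ge0 // -?invrN ?invr_ge0 oppr_ge0 //.
  by rewrite subr_le0.
(* With the shortest step, [e2] becomes integral and no arc overshoots its integer. *)
case: (@arg_minP _ _ _ e1 (fun e => g e != 0) r ge1) => e2 ge2 rmin.
pose f' e := f e + r e2 * g e.
have f'2 : f' e2 = h e2 by rewrite /f' /r divfK // subrKC.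
have f'g e : g e = 0 -> f' e = f e by rewrite /f' => ->; rewrite mulr0 addr0.
have f'h e : g e != 0 -> (f e <= f' e <= h e) || (h e <= f' e <= f e).
  move=> ge; have := rmin e ge; have := r0 e2; rewrite /f'.
  have -> : h e = f e + r e * g e by rewrite /r divfK // subrKC.
  move: (r e) (r e2) => x y y0 yx; have [gp|gn] := ltrP 0 (g e).
    by apply/orP; left; apply/andP; split; nra.
  by apply/orP; right; apply/andP; split; nra.
have f'u e : 0 <= f' e <= u e.
  have [/f'g->//|/f'h] := eqVneq (g e) 0.
  have := fu e; have := hu e; lra.
have f'c v : excess [set: A] f' [set v] = excess [set: A] f [set v].
  rewrite -[RHS]addr0 -[X in _ + X](mulr0 (r e2)) -[X in _ * X](gc v) /excess.
  by rewrite mulr_sumr -big_split; apply: eq_bigr => e _ /=; rewrite /f'; ring.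
have f'w : cost w f' <= cost w f.
  have -> : cost w f' = cost w f + r e2 * cost w g.
    rewrite /cost mulr_sumr -big_split; apply: eq_bigr => e _ /=.
    by rewrite /f'; ring.
  by have := r0 e2; nra.
have [||f'' [? ? f''c f''w]] := IHn f' _ f'u.
- move: Bn; rewrite ltnS; apply: leq_trans; apply: proper_card; apply/properP; split.
    apply/fintype.subsetP => e; rewrite inE => nf'; apply: contraNT nf' => eB.
    by rewrite f'g ?gB //; move: eB; rewrite inE negbK.
  exists e2; first by apply: contraNT ge2 => /gB->.
  by rewrite inE f'2 negbK intr_int.
- by move=> v; rewrite f'c.
exists f''; split=> // [v|]; first by rewrite f''c.
exact: le_trans f''w f'w.
Qed.

End Network.

Lemma int_num_ge1 (R : archiRealDomainType) (x : R) :
  x \is a Num.int -> 0 <= x -> x != 0 -> 1 <= x.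
Proof.
case/intrP=> m ->; rewrite ler0z intr_eq0 ler1z => m0 mn0.
by rewrite -gtz0_ge1 lt_neqAle eq_sym mn0.
Qed.

(** * The upper bound [k+1] *)

Section UpperBound.
Variables (R : realType) (I : ftp_instance R).
Implicit Types (x f : arc I -> R) (B F S : {set arc I}) (X : {set vertex I}).

Let net := @excess R _ _ (@tail R I) (@head R I).
Let cap := @in_capacity R _ _ (@tail R I) (@head R I).

Lemma net_set1 B f v : net B f [set v] =
  \sum_(e in B | head e == v) f e - \sum_(e in B | tail e == v) f e.
Proof.
rewrite !big_mkcondr -sumrB; apply: eq_bigr => e _.
rewrite /incidence !inE mulrBr.
by case: eqP; case: eqP; rewrite ?mulr1 ?mulr0.
Qed.

(** By conservation, the excess of the complement of [X] is that of the source alone, and the excess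
    of [X] is its negative. *)
Lemma flow_value_le_in_capacity B x f X : st_flow B x f ->
  source I \notin X -> target I \in X -> flow_value B f <= cap B x X.
Proof.
case=> fx fc sX tX.
have -> : flow_value B f = - net B f [set source I].
  by rewrite net_set1 opprB.
have <- : net B f (~: X) = net B f [set source I].
  rewrite /net -excess_sum (bigD1 (source I)) ?inE //= big1 ?addr0 // => v.
  rewrite inE => /andP[vX vs]; rewrite -/net net_set1 fc ?subrr //.
  by apply: contraNneq vX => ->.
have <- : net B f X = - net B f (~: X).
  rewrite /net /excess -sumrN; apply: eq_bigr => e _.
  rewrite -mulrN /incidence !inE.
  by case: (head e \in X); case: (tail e \in X) => /=; congr (_ * _); ring.
exact: excess_le_in_capacity.
Qed.

Lemma frac_ftp_cut x F X : frac_ftp_feasible x -> fault_set F ->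
  source I \notin X -> target I \in X -> 1 <= cap (~: F) x X.
Proof.
case=> x01 x_max /x_max flow1 sX tX; apply: le_trans flow1 _.
apply: ge_sup => [|_ [f fx <-]]; last exact: flow_value_le_in_capacity.
exists (flow_value (~: F) (fun=> 0)); exists (fun=> 0) => //.
split=> [e _|v _ _]; last by rewrite !big1.
by rewrite lexx; case/andP: (x01 e).
Qed.

Lemma connect_contains_st_path B :
  connect (adjacent B) (source I) (target I) -> contains_st_path B.
Proof.
case/connectP=> p p_path; rewrite /contains_st_path => ->; case/shortenP: p_path => q q_path q_uniq _.
by exists q.
Qed.

Let K : R := (faults I).+1%:R.

Let truncated_capacity x e : R :=
  if e \in vulnerable I then Num.min 1 (K * x e) else K * x e.

Lemma truncated_cut x X : frac_ftp_feasible x ->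
  source I \notin X -> target I \in X ->
  K <= cap [set: arc I] (truncated_capacity x) X.
Proof.
move=> x_feas sX tX; have [x01 _] := x_feas.
have K0 : 0 < K by rewrite ltr0n.
have y0 e : 0 <= truncated_capacity x e.
  have /andP[x0 _] := x01 e; have Kx0 : 0 <= K * x e by rewrite mulr_ge0 // ltW.
  by rewrite /truncated_capacity; case: ifP => // _; rewrite le_min ler01.
(* The arcs of the cut that are truncated to 1. *)
pose F := [set e in vulnerable I |
  (head e \in X) && (tail e \notin X) && (1 <= K * x e)].
have [Fk|Fk] := leqP #|F| (faults I).
  have F_fault : fault_set F.
    rewrite /fault_set Fk andbT; apply/fintype.subsetP => e.
    by rewrite inE => /andP[].
  have := frac_ftp_cut x_feas F_fault sX tX.
  rewrite -(ler_pM2l K0) mulr1 => /le_trans; apply.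
  rewrite /cap /in_capacity mulr_sumr big_mkcond [leRHS]big_mkcond.
  apply: ler_sum => e _; rewrite inE [_ \in [set: _]]inE.
  have := y0 e; have := x01 e; rewrite inE /truncated_capacity.
  case: (e \in vulnerable I) => /=.
    case: (head e \in X); case: (tail e \in X) => //=; try lra.
    by case: (leP 1 (K * x e)) => /=; lra.
  by case: (head e \in X); case: (tail e \in X) => //=; lra.
(* Otherwise at least [k+1] arcs of the cut have capacity 1 each. *)
apply: (@le_trans _ _ #|F|%:R); first by rewrite ler_nat.
rewrite -sum1_card natr_sum /cap /in_capacity.
rewrite big_mkcond [leRHS]big_mkcond; apply: ler_sum => e _ /=.
rewrite inE [_ \in [set: _]]inE.
have := y0 e; rewrite /truncated_capacity.
case: (e \in vulnerable I) => /=; last by move=> ?; rewrite mulr_ge0.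
case: (head e \in X); case: (tail e \in X) => //=; try lra.
by case: (leP 1 (K * x e)) => /=; lra.
Qed.

(* An integral flow of value k+1 that sends at most one unit over each
   vulnerable arc survives k faults. *)
Lemma support_ftp_feasible f : (forall e, 0 <= f e) ->
  (forall e, e \in vulnerable I -> f e <= 1) ->
  (forall X, source I \notin X -> target I \in X ->
     K <= net [set: arc I] f X) ->
  ftp_feasible [set e | f e != 0].
Proof.
move=> f0 f1 fK F /andP[/fintype.subsetP Fvul Fk].
set S := [set e | _]; apply/connect_contains_st_path/negPn/negP => st.
(* Vertices cut off from the source. Flow enters [X] only through arcs of [F], each carrying at most
   1, so at most [k] in total. *)
pose X := [set v | ~~ connect (adjacent (S :\: F)) (source I) v].
have /fK/(_ _) : source I \notin X by rewrite inE connect0.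
rewrite inE st => /(_ isT); apply/negP; rewrite -ltNge.
apply: (@le_lt_trans _ _ #|F|%:R); last by rewrite ltr_nat ltnS.
apply: (le_trans (excess_le_in_capacity (u := f) _ _ _ _)) => [e _|].
  by rewrite f0 lexx.
rewrite -sum1_card natr_sum /in_capacity big_mkcond [leRHS]big_mkcond.
apply: ler_sum => e _; rewrite inE !inE negbK.
case: (boolP (_ && _)) => [/andP[nh ht]|_]; last by rewrite mulr0; case: ifP.
rewrite mulr1; case: ifPn => [/Fvul/f1//|eF].
have [->//|fe0] := eqVneq (f e) 0.
case/negP: nh; apply: connect_trans ht (connect1 _).
by apply/exists_inP; exists e; rewrite ?eqxx // !inE eF.
Qed.

Lemma round_frac_ftp x : frac_ftp_feasible x ->
  exists2 S : {set arc I}, ftp_feasible S & set_weight S <= K * frac_weight x.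
Proof.
move=> x_feas; have [x01 _] := x_feas.
have K0 : 0 < K by rewrite ltr0n.
have K1 : 1 <= K by rewrite ler1n.
have Kx0 e : 0 <= K * x e by have /andP[? _] := x01 e; rewrite mulr_ge0 // ltW.
have y0 e : 0 <= truncated_capacity x e.
  by rewrite /truncated_capacity; case: ifP => // _; rewrite le_min ler01 Kx0.
have yx e : truncated_capacity x e <= K * x e.
  by rewrite /truncated_capacity; case: ifP => // _; rewrite ge_min lexx orbT.
(* [k+1] units are supplied at the source and demanded at the target. *)
pose b v : R := K * ((target I \in [set v])%:R - (source I \in [set v])%:R).
have sumb X : \sum_(v in X) b v =
    K * ((target I \in X)%:R - (source I \in X)%:R).
  by rewrite -mulr_sumr sumrB !sum_mem_set1.
have [||f fy fb] := @gale_flow _ _ _ (@tail R I) (@head R I) [set: arc I]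
    (truncated_capacity x) b y0.
- have := sumb [set: _]; rewrite !inE subrr mulr0 => {2}<-.
  by apply: eq_bigl => v; rewrite inE.
- move=> X; rewrite sumb.
  have cap0 : 0 <= cap [set: arc I] (truncated_capacity x) X.
    by apply: sumr_ge0 => e _; rewrite mulr_ge0.
  have := truncated_cut (X := X) x_feas.
  move: cap0; rewrite /cap; move: (in_capacity _ _ _ _ _) => c c0.
  case: (target I \in X); case: (source I \in X) => /=; lra.
(* Integral bounds above the truncated capacities, as [x <= 1]. *)
pose u e : R := if e \in vulnerable I then 1 else K.
have fu e : 0 <= f e <= u e.
  have /andP[-> /le_trans->//] := fy e; have /andP[_ x1] := x01 e.
  rewrite /u /truncated_capacity; case: ifP => _; first by rewrite ge_min lexx.
  by rewrite ler_piMr // ltW.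
have [||f' [f'int f'u f'c f'w]] :=
    @integral_flow _ _ _ (@tail R I) (@head R I) (@weight R I) u f _ fu.
- by move=> e; rewrite /u; case: ifP => _; rewrite ?rpred1 ?rpred_nat.
- by move=> v; rewrite fb /b rpredM ?rpredB ?rpred_nat.
have f'0 e : 0 <= f' e by case/andP: (f'u e).
exists [set e | f' e != 0].
  apply: support_ftp_feasible => // [e evul|X sX tX].
    by have /andP[_] := f'u e; rewrite /u evul.
  rewrite /net -excess_sum.
  under eq_bigr do rewrite f'c fb.
  by rewrite sumb tX (negPf sX) subr0 mulr1.
apply: (@le_trans _ _ (cost (@weight R I) f')); last first.
  apply: le_trans f'w _; rewrite /frac_weight mulr_sumr.
  apply: ler_sum => e _; rewrite mulrCA ler_wpM2l ?weight_ge0 //.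
  by have /andP[_ /le_trans->] := fy e.
(* A nonzero integral flow value is at least 1, so the support weighs no more than the flow
   costs. *)
rewrite /set_weight big_mkcond; apply: ler_sum => e _; rewrite inE.
case: ifPn => [f'n0|_]; last by rewrite mulr_ge0 ?weight_ge0.
by rewrite ler_peMr ?weight_ge0 // int_num_ge1.
Qed.

Lemma ftp_opt_le_frac : (ftp_opt I <= K%:E * frac_ftp_opt I)%E.
Proof.
have K0 : 0 < K by rewrite ltr0n.
rewrite -lee_pdivrMl //; apply: le_ereal_inf_tmp => _ [x x_feas <-].
have [S S_feas Sw] := round_frac_ftp x_feas.
rewrite lee_pdivrMl // -EFinM; apply: ge_ereal_inf.
by exists (set_weight S)%:E; [exists S | rewrite lee_fin].
Qed.

End UpperBound.

(** * The tight family *)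

Section LowerBound.
Variables (R : realType) (k n : nat).

Let N := (n + k).+1.

Let tight_tail (e : 'I_N * bool) : bool + 'I_N :=
  if e.2 then inr e.1 else inl false.

Let tight_head (e : 'I_N * bool) : bool + 'I_N :=
  if e.2 then inl true else inr e.1.

Let tight_weight (e : 'I_N * bool) : R := (~~ e.2)%:R.

Let tight_weight_ge0 e : 0 <= tight_weight e.
Proof. exact: ler0n. Qed.

(* [n + k + 1] parallel vulnerable unit-weight arcs, each followed by a safe
   arc of weight zero that keeps the digraph simple. *)
Definition tight_instance : ftp_instance R :=
  @FTPInstance R (bool + 'I_N)%type ('I_N * bool)%type tight_tail tight_head
    tight_weight tight_weight_ge0 (inl false) (inl true)
    [set e | ~~ e.2]%SET k.

Lemma card_tight_vertex : #|vertex tight_instance| = (n + k).+3.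
Proof. by rewrite card_sum card_bool card_ord. Qed.

Lemma tight_simple : simple_digraph tight_instance.
Proof.
by split=> [[i []] [j []]|[i []]] //= [] // ->.
Qed.

(** Every arc leaving the source is vulnerable, so a solution with at most [k] of them loses them
    all to one fault set. *)
Lemma tight_ftp_opt : (k.+1%:R%:E <= ftp_opt tight_instance)%E.
Proof.
apply: le_ereal_inf_tmp => _ [S S_feas <-]; rewrite lee_fin.
pose F : {set arc tight_instance} := [set e in S | ~~ e.2].
have -> : set_weight S = #|F|%:R.
  rewrite -sum1_card natr_sum /set_weight big_mkcond [RHS]big_mkcond.
  apply: eq_bigr => -[i b] _; rewrite inE /= /tight_weight /=.
  by case: (_ \in S); case: b.
rewrite ler_nat ltnNge; apply/negP => Fk.
have F_fault : fault_set F.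
  rewrite /fault_set Fk andbT; apply/fintype.subsetP => e.
  by rewrite !inE => /andP[].
have [[|v p] [/= sp]] := S_feas F F_fault; first by [].
case/andP: sp => /exists_inP[[i []]]; rewrite !inE //= => /andP[+ iS].
by rewrite iS.
Qed.

Lemma tight_frac_ftp_opt :
  (frac_ftp_opt tight_instance <= (N%:R / n.+1%:R)%:E)%E.
Proof.
pose c : R := n.+1%:R^-1.
have c0 : 0 <= c by rewrite invr_ge0.
pose x (e : arc tight_instance) : R := if e.2 then 1 else c.
have x01 e : 0 <= x e <= 1.
  by rewrite /x; case: ifP => _; rewrite ?ler01 ?lexx // c0 invf_le1 ?ler1n.
apply: ereal_inf_lbound; exists x; last first.
  congr EFin; rewrite /frac_weight.
  rewrite -(pair_bigA _ (fun i b => tight_weight (i, b) * x (i, b))) /=.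
  rewrite (eq_bigr (fun=> c)) => [|i _].
    by rewrite sumr_const card_ord -[LHS]mulr_natl.
  by rewrite big_bool /tight_weight /x /= mul0r mul1r add0r.
split=> // F /andP[Fvul Fk].
(* Send [c] along each two-arc route whose vulnerable arc survives; at least [n+1] do. *)
pose f (e : arc tight_instance) : R := if (e.1, false) \in F then 0 else c.
have f_flow : st_flow (~: F) x f.
  split=> [[i b] _|v].
    rewrite /f /x /=; case: ifP => _; case: b; rewrite ?lexx ?ler01 ?c0 //.
    by rewrite invf_le1 ?ler1n.
  case: v => [[]//|i] _ _.
  have iT : (i, true) \notin F.
    by apply/negP => /(fintype.subsetP Fvul); rewrite inE.
  rewrite [RHS](big_pred1 (i, true)) => [|[j []]]; last 2 first.
  - rewrite inE /= (inj_eq inr_inj) xpair_eqE andbT /=.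
    by case: eqVneq => [->|_]; rewrite ?iT ?andbF.
  - by rewrite andbF /= xpair_eqE andbF.
  rewrite /f /=; case: ifPn => [iF|iF].
    by rewrite big1 // => -[j []] /andP[_] //= /eqP[->]; rewrite iF.
  rewrite (big_pred1 (i, false)) /= => [|[j []]]; first by rewrite (negPf iF).
  - by rewrite andbF /= xpair_eqE andbF.
  - rewrite inE /= (inj_eq inr_inj) xpair_eqE andbT /=.
    by case: eqVneq => [->|_]; rewrite ?iF ?andbF.
have f_value : 1 <= flow_value (~: F) f.
  rewrite /flow_value [X in _ - X]big1 => [|[j []]]; last 2 first.
  - by rewrite /= andbF.
  - by rewrite /= andbF.
  rewrite subr0 big_mkcond /=.
  pose G i b := if ((i, b) \in ~: F) && ~~ b then f (i, b) else 0.
  rewrite (eq_bigr (fun e => G e.1 e.2)) => [|[i []] _ //].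
  rewrite -(pair_bigA _ G) /G /=.
  pose F1 := [set i : 'I_N | (i, false) \in F]%SET.
  have F1k : (#|F1| <= k)%N.
    apply: leq_trans Fk; rewrite -(card_imset _ (f := fun i : 'I_N => (i, false))).
      apply: subset_leq_card; apply/fintype.subsetP => e /imsetP[i + ->].
      by rewrite inE.
    by move=> i j [].
  rewrite (eq_bigr (fun i => if i \in ~: F1 then c else 0)) => [|i _].
    rewrite -big_mkcond sumr_const -[leRHS]mulr_natl ler_pdivlMr // mul1r ler_nat.
    rewrite -(leq_add2l #|F1|) cardsC card_ord /N addnC addSn ltnS.
    by rewrite leq_add2l.
  by rewrite big_bool /= andbF add0r andbT !inE /f; case: (_ \in F).
apply: le_trans f_value _; apply: ub_le_sup; last by exists f.
(* The cut at the target bounds all flow values, so the supremum is meaningful. *)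
exists (in_capacity (@tail R tight_instance) (@head R tight_instance) (~: F) x
  [set inl true]) => _ [g g_flow <-].
by apply: flow_value_le_in_capacity g_flow _ _; rewrite inE.
Qed.

End LowerBound.

(** * Both bounds combined, and the limit of the ratio *)

Local Open Scope classical_set_scope.
Local Open Scope ring_scope.

Theorem theorem10 (R : realType) :
  (forall I : ftp_instance R,
     (ftp_opt I <= (faults I).+1%:R%:E * frac_ftp_opt I)%E) /\
  (forall k : nat, exists J : nat -> ftp_instance R,
     [/\ forall n, faults (J n) = k,
         injective (fun n => #|vertex (J n)|),
         forall n, simple_digraph (J n),
         forall n, (0 < frac_ftp_opt (J n) < +oo)%E
       & (fun n => fine (ftp_opt (J n)) / fine (frac_ftp_opt (J n)))
           @ \oo --> (k.+1%:R : R)]).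
Proof.
split=> [I|k]; first exact: ftp_opt_le_frac.
have K0 : 0 < k.+1%:R :> R by rewrite ltr0n.
have opt n : exists a b : R, [/\ ftp_opt (tight_instance R k n) = a%:E,
    frac_ftp_opt (tight_instance R k n) = b%:E,
    0 < b, k.+1%:R <= a <= k.+1%:R * b & b <= (n + k).+1%:R / n.+1%:R].
  have := ftp_opt_le_frac (tight_instance R k n).
  have := tight_ftp_opt R k n; have := tight_frac_ftp_opt R k n.
  (* A fractional optimum of [-oo] would force the same for [ftp_opt], which is at least [k+1]. *)
  case: (frac_ftp_opt _) => [b| |] //= b_le; last first.
    by rewrite mulr_infty gtr0_sg // mul1e leeNy_eq => + /eqP aE; rewrite aE.
  case: (ftp_opt _) => [a| |] //; rewrite -?EFinM ?lee_fin // => Ka ab.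
  exists a, b; split=> //; last by rewrite Ka ab.
    by rewrite -(pmulr_rgt0 _ K0) (lt_le_trans K0) // (le_trans Ka).
exists (tight_instance R k); split=> // [m n|n|n|].
- by rewrite !card_tight_vertex => -[] /addIn.
- exact: tight_simple.
- by have [a [b [_ -> b0 _ _]]] := opt n; rewrite lte_fin b0 ltry.
(* The ratio lies between [(k+1) * (1 - k/(n+1))] and [k+1]. *)
- apply: (@squeeze_cvgr _ _ _ _
      (fun n => k.+1%:R - k.+1%:R * k%:R * harmonic n) (fun=> k.+1%:R)).
  + apply: nearW => n; have [a [b [-> -> b0 /andP[Ka ab] b_le]]] := opt n.
    rewrite /= ler_pdivrMr // ab andbT ler_pdivlMr //.
    apply: le_trans Ka; move: b_le.
    have h0 : 0 < n.+1%:R^-1 :> R by rewrite invr_gt0.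
    have -> : (n + k).+1%:R / n.+1%:R = 1 + k%:R * n.+1%:R^-1 :> R.
      by rewrite -addSn natrD mulrDl divff.
    move: (n.+1%:R^-1) (k.+1%:R) K0 h0 (ler0n R k) => h K K0 h0 k0 b_le.
    rewrite -mulrA -[X in X - _]mulr1 -mulrBr -mulrA ler_piMr //; first exact: ltW.
    (* With [t = k/(n+1)] and [b <= 1 + t], the product [(1 - t) * b] is at most [1 - t^2] if
       [t <= 1], and negative otherwise. *)
    by move: (k%:R * h) b_le (mulr_ge0 k0 (ltW h0)) => t; have [] := lerP t 1; nra.
  + rewrite -[X in _ --> X]subr0 -[X in _ - X](mulr0 (k.+1%:R * k%:R)).
    by apply: cvgB; [exact: cvg_cst | apply: cvgMr; exact: cvg_harmonic].
  + exact: cvg_cst.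
Qed.
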